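(* Let $\beta=\frac{\left(3\sqrt{708}-\frac{629}{8}\right)^{1/3}}{12}-\frac{23}{48\left(3\sqrt{708}-\frac{629}{8}\right)^{1/3}}-\frac{5}{24}\approx -0.5707202942$. Then the set of real roots of all-terminal reliability polynomials of connected (simple) graphs is dense in the interval $[\beta,0]$; that is, every point of $[\beta,0]$ lies in the closure of the set $\{x\in\mathbb{R}: \mathrm{Rel}(G;x)=0 \text{ for some connected simple graph } G\}$.
   Context: A (simple) graph $G=(V,E)$ has a finite vertex set and a set $E$ of unordered pairs of distinct vertices (no multiple edges). For a connected graph $G$ in which each edge fails independently with probability $q$, the all-terminal reliability is $\mathrm{Rel}(G;q)=\sum_{E'}(1-q)^{|E'|}q^{|E|-|E'|}$, where the sum ranges over all $E'\subseteq E$ such that the spanning subgraph $(V,E')$ is connected; this is a polynomial in $q$, and its roots are called reliability roots. *)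

(* Defs.v *)
From HB Require Import structures.
From mathcomp Require Import all_boot all_order all_algebra.
From mathcomp Require Import all_classical all_reals all_analysis.
Set Implicit Arguments.
Unset Strict Implicit.
Unset Printing Implicit Defensive.
Import Order.TTheory GRing.Theory Num.Theory.
Import numFieldNormedType.Exports.
Local Open Scope classical_set_scope.
Local Open Scope ring_scope.

Record sgraph := SGraph {
  vertex : finType;
  edges : {set {set vertex}};
  edges_card2 : forall e : {set vertex}, e \in edges -> #|e| = 2%N
}.

Definition adj (V : finType) (A : {set {set V}}) : rel V :=
  fun u v => [set u; v]%SET \in A.

(* (V, A) is connected; the graph without vertices is not. *)
Definition spanning_connected (V : finType) (A : {set {set V}}) : bool :=
  (0 < #|V|)%N && [forall u : V, forall v : V, connect (adj A) u v].

Definition connected_sgraph (G : sgraph) : bool := spanning_connected (edges G).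

Definition Rel (R : realType) (G : sgraph) : {poly R} :=
  \sum_(A : {set {set vertex G}} | (A \subset edges G) && spanning_connected A)
     (1 - 'X) ^+ #|A| * 'X ^+ (#|edges G| - #|A|).

Definition real_reliability_roots (R : realType) : set R :=
  [set x : R | exists G : sgraph, connected_sgraph G /\ root (Rel R G) x].
Arguments real_reliability_roots : clear implicits.

(* The base is positive, so [`^ 3^-1] is the real cube root. *)
Definition beta_cbrt (R : realType) : R :=
  (3 * Num.sqrt 708 - 629 / 8) `^ (3^-1).

Definition beta (R : realType) : R :=
  beta_cbrt R / 12 - 23 / (48 * beta_cbrt R) - 5 / 24.

(* Main.v *)
Require Import Defs.
From HB Require Import structures.
From mathcomp Require Import all_boot all_order all_algebra.
From mathcomp Require Import all_classical all_reals all_analysis.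
From mathcomp Require Import ring lra.
Set Implicit Arguments.
Unset Strict Implicit.
Unset Printing Implicit Defensive.
Import Order.TTheory GRing.Theory Num.Theory.
Import numFieldNormedType.Exports.
Local Open Scope classical_set_scope.
Local Open Scope ring_scope.

(**
The graphs are cycles with [m + 1] edges, each replaced by [k] parallel copies of a
two-terminal gadget. Let S be the probability that the gadget falls into two pieces,
one for each terminal, and T the probability of this or of being connected. Then
Rel = (T^k - S^k)^m (m S^k + T^k), so q is a root as soon as (S/T)^k = -1/m; for odd k
and m >= 1 the numbers (-1/m)^(1/k) are dense in [-1, 0]. With a path of length two as
gadget, S/T = 2q/(1+q) increases from -1 to 0 on [-1/3, 0]. With K_4 minus the edge
between the terminals, S/T = 2q^2(1+3q)/((1+q)(1+q+2q^2)) increases from -1 to 0 on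
[beta, -1/3], because beta is the real root of 8q^3+5q^2+2q+1.

Rel is computed from the Potts partition function with N colours, as the coefficient
of N: there a gadget contributes a factor depending only on whether its terminals have
equal colours, and the cycle is summed with a transfer matrix.
*)

(** * Reliability as a coefficient of the Potts partition function *)

Definition monochromatic (V C : finType) (s : V -> C) (e : {set V}) : bool :=
  [forall u in e, forall v in e, s u == s v].

Lemma monochromatic2 (V C : finType) (s : V -> C) (u v : V) :
  monochromatic s [set u; v]%SET = (s u == s v).
Proof.
apply/idP/idP.
  move=> /forall_inP/(_ u); rewrite !inE eqxx => /(_ isT).
  by move=> /forall_inP/(_ v); rewrite !inE eqxx orbT => /(_ isT).
move=> /eqP suv; apply/forall_inP => a; rewrite !inE => /orP ha.
apply/forall_inP => b; rewrite !inE => /orP hb.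
by case: ha => /eqP ->; case: hb => /eqP ->; rewrite ?suv.
Qed.

Lemma adj_connect_sym (V : finType) (A : {set {set V}}) : connect_sym (adj A).
Proof. by apply: sym_connect_sym => u v; rewrite /adj finset.setUC. Qed.

(** [fingraph.roots] holds one representative per component. The empty vertex set has none, in
    accordance with the convention that it is not connected. *)
Lemma spanning_connectedE (V : finType) (A : {set {set V}}) :
  spanning_connected A = (#|fingraph.roots (adj A)| == 1%N).
Proof.
have sA := adj_connect_sym A.
apply/idP/idP.
  case/andP => /card_gt0P[x _] /forallP cA.
  rewrite (eq_card (B := pred1 (fingraph.root (adj A) x))) ?card1 // => y.
  rewrite !inE.
  apply/idP/eqP => [/eqP <-|->]; last exact: roots_root.
  by apply/eqP; rewrite root_connect //; apply: (forallP (cA y)).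
move=> r1; apply/andP; split.
  by apply: leq_trans (max_card (fingraph.roots (adj A))); rewrite (eqP r1).
apply/forallP => u; apply/forallP => v; rewrite -root_connect //.
by apply/eqP; apply: (card_le1_eqP (eq_leq (eqP r1))); exact: roots_root.
Qed.

(** Such a colouring is constant on components, hence is determined by its arbitrary values at the
    component roots. *)
Lemma card_monochromatic (V C : finType) (A : {set {set V}}) :
  (forall e : {set V}, e \in A -> #|e| = 2) ->
  #|[set s : {ffun V -> C} | [forall e in A, monochromatic s e]]%SET| =
  (#|C| ^ #|fingraph.roots (adj A)|)%N.
Proof.
move=> A2; have sA := adj_connect_sym A.
set r := fingraph.root (adj A).
have <- : #|{ffun {x | fingraph.roots (adj A) x} -> C}| =
    (#|C| ^ #|fingraph.roots (adj A)|)%N by rewrite card_ffun card_sig.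
pose ext (t : {ffun {x | fingraph.roots (adj A) x} -> C}) :=
  [ffun v => t (exist _ (r v) (roots_root sA v))].
have ext_inj : injective ext.
  move=> t t' /ffunP tt'; apply/ffunP => -[x rx].
  move: (tt' x); rewrite !ffunE.
  have /eqP e : r x == x := rx.
  by move: (roots_root sA x); rewrite -/r e => h; rewrite (bool_irrelevance rx h).
rewrite -(card_imset predT ext_inj); apply: eq_card => s.
rewrite inE; apply/idP/imsetP => [/forall_inP mono|[t _ ->]].
  have mono_r v : s (r v) = s v.
    rewrite /r; have /connectP[p pth ->] := connect_root (adj A) v.
    elim: p v pth => //= w p IH v /andP[vw /IH ->].
    by move: (mono _ vw); rewrite monochromatic2 => /eqP.
  exists [ffun x => s (val x)] => //.
  by apply/ffunP => v; rewrite !ffunE /= mono_r.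
apply/forall_inP => e eA.
have /eqP/cards2P[u [v [uv ee]]] := A2 _ eA.
have ruv : r u = r v.
  by apply/eqP; rewrite root_connect //; apply: connect1; rewrite /adj -ee.
rewrite ee monochromatic2 !ffunE; apply/eqP; congr (t _).
exact: val_inj.
Qed.

(* The Fortuin-Kasteleyn expansion of the Potts partition function. *)
Lemma potts_subset_expansion (K : comNzRingType) (V C : finType)
    (E : {set {set V}}) (x y : K) :
  (forall e : {set V}, e \in E -> #|e| = 2) ->
  \sum_(s : {ffun V -> C}) \prod_(e in E) (x * (monochromatic s e)%:R + y) =
  \sum_(A : {set {set V}} | A \subset E)
     x ^+ #|A| * y ^+ (#|E| - #|A|) * (#|C| ^ #|fingraph.roots (adj A)|)%:R.
Proof.
move=> E2.
transitivity (\sum_(s : {ffun V -> C}) \sum_(A : {set {set V}} | A \subset E)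
    x ^+ #|A| * y ^+ (#|E| - #|A|) * [forall e in A, monochromatic s e]%:R).
  apply: eq_bigr => s _.
  rewrite big_mkcond /=.
  under eq_bigr => e _.
    (* Sets outside [E] get the factor 0 + 1, so the product can be expanded over all sets; a choice
       [A] not contained in [E] then contributes 0. *)
    rewrite (_ : (if _ then _ else _) =
      (if e \in E then x * (monochromatic s e)%:R else 0) +
      (if e \in E then y else 1)); last by case: ifP; rewrite ?add0r.
    over.
  rewrite bigA_distr [RHS]big_mkcond /=; apply: eq_bigr => A _.
  case: ifPn => [AE|/subsetPn[e eA eE]]; last first.
    by rewrite (bigD1 e) //= eA (negPf eE) mul0r.
  rewrite (bigID (mem A)) /=.
  rewrite (eq_bigr (fun e => x * (monochromatic s e)%:R)); last first.
    by move=> e eA; rewrite eA (fintype.subsetP AE).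
  rewrite [X in _ * X](eq_bigr (fun e => if e \in E then y else 1)); last first.
    by move=> e /negPf ->.
  rewrite -big_mkcondr /= big_const -Monoid.iteropE /=.
  rewrite big_split /= prodr_const -natr_prod.
  rewrite mulrAC; congr (_ * _ * _).
    congr (y ^+ _); rewrite -(cardsDS AE).
    by apply: eq_card => e; rewrite !inE.
  congr (_%:R).
  have [/forall_inP m|] := boolP [forall e in A, monochromatic s e].
    by rewrite big1 // => e eA; rewrite m.
  rewrite negb_forall => /existsP[e]; rewrite negb_imply => /andP[eA /negPf me].
  by rewrite (bigD1 e) //= me.
rewrite exchange_big /=; apply: eq_bigr => A AE.
rewrite -mulr_sumr -natr_sum -card_monochromatic; last first.
  by move=> e eA; apply: E2; apply: (fintype.subsetP AE).
congr (_ * _%:R); rewrite -sum1_card [RHS]big_mkcond /=.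
by apply: eq_bigr => s _; rewrite inE; case: ifP.
Qed.

Lemma poly_eq_on_nat (K : numDomainType) (P Q : {poly K}) :
  (forall n : nat, P.[n%:R] = Q.[n%:R]) -> P = Q.
Proof.
move=> PQ; apply/eqP; rewrite -subr_eq0; apply/negPn/negP => nz.
pose rs := [seq n%:R : K | n <- iota 0 (size (P - Q))].
have : (size rs < size (P - Q)%R)%N.
  apply: max_poly_roots => //.
    by apply/allP => _ /mapP[n _ ->]; rewrite rootE hornerD hornerN PQ subrr.
  by rewrite map_inj_uniq ?iota_uniq // => a b /eqP; rewrite eqr_nat => /eqP.
by rewrite size_map size_iota ltnn.
Qed.

(** In the subset expansion the exponent of the number of colours counts components, so degree 1
    collects exactly the connected spanning subgraphs. *)
Lemma horner_Rel_potts (R : realType) (G : sgraph) (q : R) (Z : {poly R}) :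
  (forall n : nat, Z.[n%:R] =
     \sum_(s : {ffun vertex G -> 'I_n})
        \prod_(e in edges G) ((1 - q) * (monochromatic s e)%:R + q)) ->
  (Rel R G).[q] = Z`_1.
Proof.
move=> hZ.
have -> : Z = \sum_(A : {set {set vertex G}} | A \subset edges G)
    ((1 - q) ^+ #|A| * q ^+ (#|edges G| - #|A|))
       *: 'X^#|fingraph.roots (adj A)|.
  apply: poly_eq_on_nat => n; rewrite hZ potts_subset_expansion; last first.
    exact: edges_card2.
  rewrite horner_sum; apply: eq_bigr => A _.
  by rewrite hornerZ hornerXn card_ord natrX.
rewrite coef_sum /Rel horner_sum big_mkcondr /=; apply: eq_bigr => A _.
rewrite coefZ coefXn spanning_connectedE eq_sym; case: eqP => _; last by rewrite mulr0.
by rewrite mulr1 hornerM !horner_exp hornerD hornerN hornerC hornerX.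
Qed.

Lemma spanning_connectedS (V : finType) (A E : {set {set V}}) :
  A \subset E -> spanning_connected A -> spanning_connected E.
Proof.
move=> /fintype.subsetP AE /andP[V0 cA]; rewrite /spanning_connected V0.
apply/forallP => u; apply/forallP => v.
apply: connect_sub (forallP (forallP cA u) v) => a b ab.
by apply: connect1; apply: AE.
Qed.

(** This spares the construction of paths: connectedness will follow from one nonzero value of the
    polynomial. *)
Lemma Rel_neq0_connected (R : realType) (G : sgraph) :
  Rel R G != 0 -> connected_sgraph G.
Proof.
apply: contraR => nc; rewrite /Rel big_pred0 // => A.
by apply/negP => /andP[/spanning_connectedS h /h]; apply/negP.
Qed.

(** * Sums over colourings and the transfer matrix *)

Lemma sum_ffun_sum (K : nmodType) (I J C : finType) (F : {ffun I + J -> C} -> K) :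
  \sum_s F s = \sum_(f : {ffun I -> C}) \sum_(g : {ffun J -> C})
     F [ffun v => match v with inl i => f i | inr j => g j end].
Proof.
pose h (fg : {ffun I -> C} * {ffun J -> C}) : {ffun I + J -> C} :=
  [ffun v => match v with inl i => fg.1 i | inr j => fg.2 j end].
rewrite pair_big (reindex h) //=.
exists (fun s : {ffun I + J -> C} => ([ffun i => s (inl i)], [ffun j => s (inr j)])).
  by move=> [f g] _; congr (_, _); apply/ffunP => i; rewrite !ffunE.
by move=> s _; apply/ffunP => -[i|j]; rewrite !ffunE.
Qed.

Lemma sum_ffun_ord_recr (K : nmodType) (n : nat) (C : finType)
    (F : {ffun 'I_n.+1 -> C} -> K) :
  \sum_s F s = \sum_(f : {ffun 'I_n -> C}) \sum_c
     F [ffun i => if unlift ord_max i is Some j then f j else c].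
Proof.
pose h (fc : {ffun 'I_n -> C} * C) : {ffun 'I_n.+1 -> C} :=
  [ffun i => if unlift ord_max i is Some j then fc.1 j else fc.2].
rewrite pair_big (reindex h) //=.
exists (fun s : {ffun 'I_n.+1 -> C} => ([ffun i => s (lift ord_max i)], s ord_max)).
  move=> [f c] _; congr (_, _); last by rewrite ffunE unlift_none.
  by apply/ffunP => i; rewrite !ffunE liftK.
by move=> s _; apply/ffunP => i; rewrite !ffunE; case: unliftP => [j|] ->; rewrite ?ffunE.
Qed.

Lemma sum_indicator (K : nzRingType) (C : finType) (d : K) (x : C) :
  \sum_c d * (x == c)%:R = d.
Proof.
rewrite (bigD1 x) //= eqxx mulr1 big1 ?addr0 // => c.
by rewrite eq_sym => /negPf ->; rewrite mulr0.
Qed.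

(* The n-th power of the matrix [a + b * (x == y)] indexed by N colours is
   [path_weight N a b n + b ^+ n * (x == y)]. *)
Fixpoint path_weight (K : nzRingType) (N a b : K) (n : nat) : K :=
  if n is m.+1 then (N * a + b) * path_weight N a b m + a * b ^+ m else 0.

Lemma horner_path_weight (K : comNzRingType) (N a b : {poly K}) (x : K) (n : nat) :
  (path_weight N a b n).[x] = path_weight N.[x] a.[x] b.[x] n.
Proof. by elim: n => [|n IH] /=; rewrite ?horner0 // !hornerE IH. Qed.

Lemma path_weight0 (K : comNzRingType) (a b : K) (n : nat) :
  path_weight 0 a b n.+1 = n.+1%:R * a * b ^+ n.
Proof.
elim: n => [|n IH]; first by rewrite /= expr0; ring.
by rewrite [LHS]/= -/(path_weight 0 a b n.+1) IH exprS -(natr1 n.+1); ring.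
Qed.

Section TransferMatrix.
Variables (K : comNzRingType) (C : finType) (a b : K).

Let w (x y : C) : K := a + b * (x == y)%:R.

(** The end weight [H] is arbitrary so that the induction can sum out the last vertex and absorb its
    edge into [H]. Taking [H] to be the closing edge gives the cycle. *)
Lemma sum_path (n : nat) (H : C -> C -> K) :
  \sum_(s : {ffun 'I_n.+1 -> C}) H (s ord0) (s ord_max) *
     (\prod_(i < n) w (s (widen_ord (leqnSn n) i)) (s (lift ord0 i))) =
  \sum_x \sum_y H x y * (path_weight #|C|%:R a b n + b ^+ n * (x == y)%:R).
Proof.
elim: n H => [|n IH] H.
  rewrite sum_ffun_ord_recr (big_pred1 (ffun0 (card_ord 0))) => [|f]; last first.
    by apply/esym/eqP/ffunP => -[].
  apply: eq_bigr => x _; rewrite big_ord0 (bigD1 x) //= big1 => [|y yx]; last first.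
    by rewrite eq_sym (negPf yx) mulr0 addr0 mulr0.
  rewrite !ffunE eqxx expr0 !mulr1 add0r addr0 mulr1.
  by have -> : ord0 = ord_max :> 'I_1; [exact: val_inj|rewrite !unlift_none].
rewrite sum_ffun_ord_recr.
transitivity (\sum_(f : {ffun 'I_n.+1 -> C})
   (\sum_c H (f ord0) c * w (f ord_max) c) *
   \prod_(i < n) w (f (widen_ord (leqnSn n) i)) (f (lift ord0 i))).
  apply: eq_bigr => f _; rewrite mulr_suml; apply: eq_bigr => c _.
  rewrite big_ord_recr /= !ffunE unlift_none.
  have e j : unlift ord_max (widen_ord (leqnSn n.+1) j) = Some j.
    rewrite (_ : widen_ord _ _ = lift ord_max j) ?liftK //.
    by apply: val_inj; rewrite /= /bump leqNgt ltn_ord.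
  have -> : ord0 = widen_ord (leqnSn n.+1) (ord0 : 'I_n.+1) by exact: val_inj.
  have -> : lift (widen_ord (leqnSn n.+1) ord0) ord_max = ord_max :> 'I_n.+2.
    exact: val_inj.
  rewrite e unlift_none -mulrA [X in _ = _ * X]mulrC; congr (_ * (_ * _)); last by rewrite e.
  apply: eq_bigr => i _; rewrite !ffunE e.
  have -> : lift (widen_ord (leqnSn n.+1) ord0) (widen_ord (leqnSn n) i) =
    widen_ord (leqnSn n.+1) (lift ord0 i) by exact: val_inj.
  by rewrite e.
have /= -> := IH (fun x y => \sum_c H x c * w y c); apply: eq_bigr => x _.
under eq_bigr do rewrite mulr_suml.
rewrite exchange_big /=; apply: eq_bigr => y _.
under eq_bigr do rewrite -mulrA.
rewrite -mulr_sumr; congr (_ * _).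
under eq_bigr => z _.
  rewrite (_ : _ * _ = a * path_weight #|C|%:R a b n + (a * b ^+ n) * (x == z)%:R +
     (b * path_weight #|C|%:R a b n) * (y == z)%:R + (b ^+ n.+1 * (x == y)%:R) * (x == z)%:R);
    last first.
    by rewrite /w exprS (eq_sym y); case: (eqVneq x z) => [->|_] /=; ring.
  over.
by rewrite !big_split /= !sum_indicator sumr_const -mulr_natr /=; ring.
Qed.

Lemma sum_cycle (n : nat) :
  \sum_(s : {ffun 'I_n.+1 -> C}) \prod_(i < n.+1) w (s i) (s (ordS i)) =
  #|C|%:R * (path_weight #|C|%:R a b n.+1 + b ^+ n.+1).
Proof.
transitivity (\sum_(s : {ffun 'I_n.+1 -> C}) w (s ord_max) (s ord0) *
     (\prod_(i < n) w (s (widen_ord (leqnSn n) i)) (s (lift ord0 i)))).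
  apply: eq_bigr => s _; rewrite big_ord_recr mulrC.
  rewrite (_ : ordS ord_max = ord0); last by apply: val_inj; rewrite /= modnn.
  congr (_ * _); apply: eq_bigr => i _.
  rewrite (_ : ordS (widen_ord _ i) = lift ord0 i) //; apply: val_inj.
  by rewrite /= modn_small // ltnS ltn_ord.
have /= -> := sum_path n (fun x y => w y x).
transitivity (\sum_(x : C) (path_weight #|C|%:R a b n.+1 + b ^+ n.+1)); last first.
  by rewrite sumr_const mulr_natl.
apply: eq_bigr => x _.
under eq_bigr => z _.
  rewrite (_ : _ * _ = a * path_weight #|C|%:R a b n + (a * b ^+ n + b * path_weight #|C|%:R a b n
      + b ^+ n.+1) * (x == z)%:R);
    last by rewrite /w exprS eq_sym; case: eqP => _ /=; ring.
  over.
by rewrite big_split /= sum_indicator sumr_const -mulr_natr; ring.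
Qed.

End TransferMatrix.

(** * Potts weights of the gadgets *)

Lemma sum_indicator2 (K : comNzRingType) (C : finType) (u v : C)
    (f : bool -> bool -> K) :
  \sum_c f (u == c) (v == c) =
  #|C|%:R * f false false + (f true false - f false false)
    + (f false true - f false false)
    + (u == v)%:R * (f true true - f true false - f false true + f false false).
Proof.
under eq_bigr => c _.
  rewrite (_ : f _ _ = f false false + (f true false - f false false) * (u == c)%:R
    + (f false true - f false false) * (v == c)%:R
    + ((u == v)%:R * (f true true - f true false - f false true + f false false))
       * (u == c)%:R); last first.
    by rewrite (eq_sym v); case: (eqVneq u c) => [->|_]; case: (eqVneq c v) => /= _; ring.
  over.
by rewrite !big_split /= !sum_indicator sumr_const -[_ *+ _]mulr_natl.
Qed.

(* The gadget with terminals u and v has two inner vertices c and d and the edges uc,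
   vc, cd; with [bridge], also ud and vd, which makes it K_4 minus uv. Without [bridge],
   d is a pendant vertex, which only multiplies all weights by a common factor.
   [gadget_sep] and [gadget_tot] are its Potts weights with N colours when u and v are
   coloured differently, resp. alike; at N = 0 they are S and T. *)
Definition gadget_sep (K : comNzRingType) (bridge : bool) (q N : K) : K :=
  let S := if bridge then N * q ^+ 2 + 2 * (1 - q) * q else N in
  let f h := h * ((1 - q) * (if bridge then h else 1) + q * S) in
  N * f (q ^+ 2) + 2 * (f q - f (q ^+ 2)).

Definition gadget_tot (K : comNzRingType) (bridge : bool) (q N : K) : K :=
  let S := if bridge then N * q ^+ 2 + (1 - q ^+ 2) else N in
  let f h := h * ((1 - q) * (if bridge then h else 1) + q * S) in
  N * f (q ^+ 2) + (f 1 - f (q ^+ 2)).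

Lemma horner_gadget_sep (K : comNzRingType) (bridge : bool) (q N : {poly K}) (x : K) :
  (gadget_sep bridge q N).[x] = gadget_sep bridge q.[x] N.[x].
Proof.
by rewrite -!/(horner_eval x _) /gadget_sep; case: bridge; ring.
Qed.

Lemma horner_gadget_tot (K : comNzRingType) (bridge : bool) (q N : {poly K}) (x : K) :
  (gadget_tot bridge q N).[x] = gadget_tot bridge q.[x] N.[x].
Proof.
by rewrite -!/(horner_eval x _) /gadget_tot; case: bridge; ring.
Qed.

Lemma sum_gadget (K : comNzRingType) (C : finType) (bridge : bool) (q : K) (u v : C) :
  let e (c d : C) := (1 - q) * (c == d)%:R + q in
  \sum_c \sum_d
    e u c * e v c * (if bridge then e u d * e v d else 1) * e c d =
  gadget_sep bridge q #|C|%:R +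
    (gadget_tot bridge q #|C|%:R - gadget_sep bridge q #|C|%:R) * (u == v)%:R.
Proof.
move=> e; pose h (x y : bool) := ((1 - q) * x%:R + q) * ((1 - q) * y%:R + q).
pose h' x y := if bridge then h x y else 1.
pose S := \sum_(d : C) h' (u == d) (v == d).
(* The edge cd is contracted with weight 1 - q, which identifies d with c, or deleted with weight q,
   which leaves the free sum [S] over d. *)
transitivity (\sum_c h (u == c) (v == c) * ((1 - q) * h' (u == c) (v == c) + q * S)).
  apply: eq_bigr => c _; rewrite -/(h (u == c) (v == c)).
  under eq_bigr => d _.
    rewrite (_ : _ * _ = h (u == c) (v == c) *
      (((1 - q) * h' (u == c) (v == c)) * (c == d)%:R + q * h' (u == d) (v == d)));
      last first.
      rewrite -mulrA; congr (_ * _); rewrite -/(h (u == d) (v == d)).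
      rewrite -/(h' (u == d) (v == d)) /e.
      by case: (eqVneq c d) => [->|_] /=; ring.
    over.
  by rewrite -mulr_sumr big_split /= sum_indicator -mulr_sumr.
rewrite (sum_indicator2 u v (fun x y => h x y * ((1 - q) * h' x y + q * S))).
rewrite /S (sum_indicator2 u v h') /gadget_sep /gadget_tot /h' /h {S h' h e}.
by case: bridge; case: eqP => _ /=; ring.
Qed.

(** * The necklace graphs and their reliability *)

Lemma set2_eq (T : finType) (a b c d : T) :
  [set a; b]%SET = [set c; d]%SET -> a = c /\ b = d \/ a = d /\ b = c.
Proof.
move=> /setP e; move: (e a) (e b) (e c) (e d); rewrite !inE !eqxx ?orbT /=.
move=> /esym/orP ha /esym/orP hb /orP hc /orP hd.
case: ha => /eqP ha; case: hb => /eqP hb; subst.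
- by case: hd => /eqP ->; left.
- by left.
- by right.
- by case: hc => /eqP ->; left.
Qed.

Section NecklaceGraph.
Variables (bridge : bool) (n k : nat).

Let X : finType := ('I_n.+2 * 'I_k)%type.
Let V : finType := ('I_n.+2 + (X + X))%type.
Let J : finType := (X * bool + X * bool + X)%type.

(* The inner vertices c and d of the copy x.2 of the gadget between the cycle vertices
   x.1 and ordS x.1 are [inr (inl x)] and [inr (inr x)]. *)
Definition necklace_edge (j : J) : {set V} :=
  match j with
  | inl (inl (x, s)) => [set inl (if s then ordS x.1 else x.1); inr (inl x)]%SET
  | inl (inr (x, s)) => [set inl (if s then ordS x.1 else x.1); inr (inr x)]%SET
  | inr x => [set inr (inl x); inr (inr x)]%SET
  end.

Definition necklace_index (j : J) : bool :=
  if j is inl (inr _) then bridge else true.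

Definition necklace_edges : {set {set V}} :=
  [set necklace_edge j | j in necklace_index]%SET.

(** A cycle with at least two vertices has no loop, so the two terminals of a gadget are
    distinct. *)
Lemma ordS_neq (i : 'I_n.+2) : ordS i <> i.
Proof.
move=> /(congr1 val) /=; have := ltn_ord i; rewrite leq_eqVlt => /orP[/eqP e|lt].
  by rewrite e modnn => i0; move: e; rewrite -i0.
by rewrite modn_small // => /eqP; rewrite eqn_leq ltnn.
Qed.

(** No two indices give the same edge, so products over the edge set become products over indices.
    Every edge has an inner vertex, which keeps the graph simple despite the parallel gadgets. *)
Lemma necklace_edge_inj : injective necklace_edge.
Proof.
have T (x : X) (s s' : bool) : (if s then ordS x.1 else x.1) =
    (if s' then ordS x.1 else x.1) -> s = s'.
  by case: s; case: s'; [|move=> /ordS_neq|move=> /esym/ordS_neq|].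
move=> [[[x s]|[x s]]|x] [[[x' s']|[x' s']]|x']; rewrite /necklace_edge;
  case/set2_eq => -[] //.
- by case=> + [ex]; rewrite -ex => /T ->.
- by case=> + [ex]; rewrite -ex => /T ->.
- by case=> ->.
Qed.

Lemma necklace_edges_card2 (e : {set V}) : e \in necklace_edges -> #|e| = 2.
Proof. by move=> /imsetP[[[[x s]|[x s]]|x] _ ->]; rewrite cards2. Qed.

Definition necklace : sgraph := SGraph necklace_edges_card2.

Lemma necklace_potts (R : realType) (q : R) (C : finType) :
  let A := gadget_sep bridge q #|C|%:R ^+ k in
  let B := gadget_tot bridge q #|C|%:R ^+ k - A in
  \sum_(s : {ffun vertex necklace -> C})
     \prod_(e in edges necklace) ((1 - q) * (monochromatic s e)%:R + q) =
  #|C|%:R * (path_weight #|C|%:R A B n.+2 + B ^+ n.+2).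
Proof.
move=> A B; rewrite -sum_cycle sum_ffun_sum; apply: eq_bigr => f _.
rewrite sum_ffun_sum.
pose e (c d : C) := (1 - q) * (c == d)%:R + q.
transitivity (\sum_(g : {ffun X -> C}) \sum_(h : {ffun X -> C}) \prod_x
   (e (f x.1) (g x) * e (f (ordS x.1)) (g x) *
    (if bridge then e (f x.1) (h x) * e (f (ordS x.1)) (h x) else 1) *
    e (g x) (h x))).
  apply: eq_bigr => g _; apply: eq_bigr => h _.
  rewrite /edges /= /necklace_edges big_imset; last by move=> ? ? _ _; apply: necklace_edge_inj.
  have prod_pair (F : X * bool -> R) :
      \prod_y F y = \prod_x (F (x, false) * F (x, true)).
    rewrite (eq_bigr (fun y => F (y.1, y.2))) => [|[]//].
    rewrite -(pair_bigA _ (fun x s => F (x, s))) /=.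
    by apply: eq_bigr => x _; rewrite big_bool mulrC.
  rewrite big_sumType big_sumType /= 2!big_split /=; congr (_ * _ * _).
  - rewrite -(prod_pair (fun y => e (f (if y.2 then ordS y.1.1 else y.1.1)) (g y.1))).
    by apply: eq_bigr => -[x s] _; rewrite monochromatic2 !ffunE.
  - rewrite (eq_bigl (fun=> bridge)) //.
    case: bridge; last by rewrite big1_eq big_pred0.
    rewrite -(prod_pair (fun y => e (f (if y.2 then ordS y.1.1 else y.1.1)) (h y.1))).
    by apply: eq_bigr => -[x s] _; rewrite monochromatic2 !ffunE.
  - by apply: eq_bigr => x _; rewrite monochromatic2 !ffunE.
(* Once the colours [f] of the cycle vertices are fixed, the sums over inner colours factor over the
   copies of the gadget. *)
under eq_bigr => g _ do rewrite -(bigA_distr_bigA (fun x d => e (f x.1) (g x) *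
  e (f (ordS x.1)) (g x) *
  (if bridge then e (f x.1) d * e (f (ordS x.1)) d else 1) * e (g x) d)).
rewrite -(bigA_distr_bigA (fun x c => \sum_d (e (f x.1) c * e (f (ordS x.1)) c *
  (if bridge then e (f x.1) d * e (f (ordS x.1)) d else 1) * e c d))).
under eq_bigr do rewrite sum_gadget.
rewrite -(pair_bigA _ (fun (i : 'I_n.+2) (_ : 'I_k) =>
  gadget_sep bridge q #|C|%:R + (gadget_tot bridge q #|C|%:R -
    gadget_sep bridge q #|C|%:R) * (f i == f (ordS i))%:R)) /=.
apply: eq_bigr => i _; rewrite prodr_const card_ord /B /A.
by case: eqP => _; rewrite ?mulr1 ?mulr0 ?addr0 // addrC subrK addrC subrK.
Qed.

(** The partition function is N times a polynomial in N, so its coefficient of N is the value of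
    that cofactor at N = 0, given by [path_weight0]. *)
Lemma horner_Rel_necklace (R : realType) (q : R) :
  let A := gadget_sep bridge q 0 ^+ k in
  let T := gadget_tot bridge q 0 ^+ k in
  (Rel R necklace).[q] = (T - A) ^+ n.+1 * (n.+1%:R * A + T).
Proof.
move=> A T.
pose a := gadget_sep bridge q%:P 'X ^+ k.
pose b := gadget_tot bridge q%:P 'X ^+ k - a.
have ha x : a.[x] = gadget_sep bridge q x ^+ k.
  by rewrite /a horner_exp horner_gadget_sep hornerC hornerX.
have hb x : b.[x] = gadget_tot bridge q x ^+ k - gadget_sep bridge q x ^+ k.
  rewrite /b hornerD hornerN ha horner_exp horner_gadget_tot.
  by rewrite hornerC hornerX.
rewrite (@horner_Rel_potts _ _ _ ('X * (path_weight 'X a b n.+2 + b ^+ n.+2))).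
  rewrite mulrC; set W := path_weight _ _ _ _ + _.
  rewrite coefMX /= -horner_coef0 {}/W hornerD horner_exp horner_path_weight.
  rewrite ha hb hornerX path_weight0 -/A -/T [in X in _ + X]exprS.
  by rewrite -(natr1 n.+1); ring.
move=> N; rewrite necklace_potts card_ord.
by rewrite hornerM hornerX hornerD horner_exp horner_path_weight hornerX ha hb.
Qed.

End NecklaceGraph.

(** At q = 0 one has S = 0 and T = 1. At least one copy is required: with none, S and T would both
    enter as the power 1 and cancel. *)
Lemma Rel_necklace_neq0 (R : realType) (bridge : bool) (n k : nat) :
  Rel R (necklace bridge n k.+1) != 0.
Proof.
apply/negP => /eqP/(congr1 (fun P => P.[0])) /eqP.
rewrite horner_Rel_necklace horner0.
have -> : gadget_sep bridge (0 : R) 0 = 0 by rewrite /gadget_sep; case: bridge; ring.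
have -> : gadget_tot bridge (0 : R) 0 = 1 by rewrite /gadget_tot; case: bridge; ring.
by rewrite expr0n expr1n mulr0 add0r subr0 expr1n mulr1 oner_eq0.
Qed.

Lemma necklace_root (R : realType) (bridge : bool) (n k : nat) (q : R) :
  n.+1%:R * gadget_sep bridge q 0 ^+ k.+1 + gadget_tot bridge q 0 ^+ k.+1 = 0 ->
  real_reliability_roots R q.
Proof.
move=> h; exists (necklace bridge n k.+1); split.
  exact: (@Rel_neq0_connected R _ (Rel_necklace_neq0 _ _ _ _)).
by rewrite rootE horner_Rel_necklace h mulr0.
Qed.

(** * Roots in prescribed intervals *)

Lemma odd_power_separation (R : realType) (s t : R) : 0 <= s -> s < t -> t < 1 ->
  exists k n : nat, n.+1%:R * s ^+ k.*2.+1 < 1 < n.+1%:R * t ^+ k.*2.+1.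
Proof.
move=> s0 st t1; have t0 : 0 < t by apply: le_lt_trans st.
have st0 : 0 <= s / t by rewrite divr_ge0 // ltW.
have z1 : `|s / t| < 1 by rewrite ger0_norm // ltr_pdivrMr // mul1r.
have [k _ hk] : \forall k \near \oo, `|0 - (s / t) ^+ k| < 2^-1.
  by apply: cvgr_dist_lt; [exact: cvg_expr|rewrite invr_gt0].
have {}hk : 2 * s ^+ k.*2.+1 < t ^+ k.*2.+1.
  have /hk : (k <= k.*2.+1)%N by rewrite -addnn -addnS leq_addr.
  rewrite /= sub0r normrN ger0_norm ?exprn_ge0 //.
  by rewrite expr_div_n ltr_pdivrMr ?exprn_gt0 // => h; lra.
have g0 : 0 < t ^+ k.*2.+1 by rewrite exprn_gt0.
have g1 : t ^+ k.*2.+1 < 1 by rewrite exprn_ilt1 // ltW.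
have s0' : 0 <= s ^+ k.*2.+1 by rewrite exprn_ge0.
(* Put g = t^(2k+1) and d = s^(2k+1), so 2d < g < 1. The integer part N of 1/g satisfies N g <= 1 <
   (N+1) g, whence (N+1) d < (1+g)/2 < 1. *)
exists k, (Num.truncn (t ^+ k.*2.+1)^-1).
have /truncn_itv/andP[h1 h2] : 0 <= (t ^+ k.*2.+1)^-1 by rewrite invr_ge0 ltW.
move: (_ ^+ _) g0 g1 s0' hk h1 h2 => g g0 g1; move: (_ ^+ _) => d d0 dg.
move: (Num.truncn _) => N h1 h2; apply/andP; split; last first.
  by rewrite -ltr_pdivrMr // mul1r.
have h3 : N%:R * g <= 1 by rewrite -ler_pdivlMr // mul1r.
rewrite -natr1; have : 0 <= (N%:R : R) by [].
nra.
Qed.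

(** The hypotheses say 0 <= -S/T at [v] < -S/T at [u] < 1. A suitable odd power and multiple
    separate these ratios by 1, so (n+1) S^(2k+1) + T^(2k+1) is negative at [u] and positive at
    [v]. *)
Lemma exists_necklace_root (R : realType) (bridge : bool) (u v : R) :
  let S q := gadget_sep bridge q 0 in let T q := gadget_tot bridge q 0 in
  u <= v -> 0 < T u -> 0 < T v ->
  S v <= 0 -> - S u < T u -> - S v * T u < - S u * T v ->
  exists2 q, u <= q <= v & real_reliability_roots R q.
Proof.
move=> S T uv Tu Tv Sv SuTu cross.
have [k [n /andP[hv hu]]] : exists k n : nat,
    n.+1%:R * (- S v / T v) ^+ k.*2.+1 < 1 < n.+1%:R * (- S u / T u) ^+ k.*2.+1.
  apply: odd_power_separation.
  - by rewrite divr_ge0 ?oppr_ge0 // ltW.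
  - by rewrite ltr_pdivrMr // mulrAC ltr_pdivlMr.
  - by rewrite ltr_pdivrMr // mul1r.
pose P : {poly R} := n.+1%:R *: gadget_sep bridge 'X 0 ^+ k.*2.+1 +
   gadget_tot bridge 'X 0 ^+ k.*2.+1.
have PE q : P.[q] = n.+1%:R * S q ^+ k.*2.+1 + T q ^+ k.*2.+1.
  rewrite /P hornerD hornerZ !horner_exp horner_gadget_sep horner_gadget_tot.
  by rewrite hornerX horner0.
have odd_div a b : 0 < b -> n.+1%:R * (- a / b) ^+ k.*2.+1 =
    - (n.+1%:R * a ^+ k.*2.+1) / b ^+ k.*2.+1 :> R.
  move=> b0; rewrite expr_div_n exprNn -signr_odd /= odd_double /= expr1.
  by rewrite mulN1r mulrA mulrN.
rewrite odd_div // ltr_pdivrMr ?exprn_gt0 // mul1r in hv.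
rewrite odd_div // ltr_pdivlMr ?exprn_gt0 // mul1r in hu.
have [|q quv /rootP rq] := @poly_ivt R P u v uv.
  by rewrite !PE; apply/andP; split; lra.
exists q => //; apply: (@necklace_root R bridge n k.*2).
by rewrite -PE.
Qed.

(** The factor (1 - q)^2, common to the four formulas, reflects that four vertices in at most two
    pieces need two working edges; it cancels in S/T. *)
Lemma gadget_sep_path (R : realType) (q : R) :
  gadget_sep false q 0 = (1 - q) ^+ 2 * (2 * q).
Proof. by rewrite /gadget_sep; ring. Qed.

Lemma gadget_tot_path (R : realType) (q : R) :
  gadget_tot false q 0 = (1 - q) ^+ 2 * (1 + q).
Proof. by rewrite /gadget_tot; ring. Qed.

Lemma gadget_sep_bridge (R : realType) (q : R) :
  gadget_sep true q 0 = (1 - q) ^+ 2 * (2 * q ^+ 2 * (1 + 3 * q)).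
Proof. by rewrite /gadget_sep; ring. Qed.

Lemma gadget_tot_bridge (R : realType) (q : R) :
  gadget_tot true q 0 = (1 - q) ^+ 2 * ((1 + q) * (1 + q + 2 * q ^+ 2)).
Proof. by rewrite /gadget_tot; ring. Qed.

(** * Density and the number [beta] *)

Lemma closure_dense_itv (R : realType) (S : set R) (a b x : R) :
  a < b -> a <= x <= b ->
  (forall u v, a < u -> u < v -> v < b -> exists2 q, u <= q <= v & S q) ->
  closure S x.
Proof.
move=> ab /andP[ax xb] dense B /nbhs_ballP[e /= e0 eB].
pose lo := Num.max a (x - e); pose hi := Num.min b (x + e).
have : lo < hi by rewrite /lo /hi lt_min !gt_max; apply/andP; split; apply/andP; split; lra.
have : a <= lo by rewrite le_max lexx.
have : x - e <= lo by rewrite le_max lexx orbT.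
have : hi <= b by rewrite ge_min lexx.
have : hi <= x + e by rewrite ge_min lexx orbT.
move: lo hi => lo hi h1 h2 h3 h4 h5.
(* The middle third keeps both endpoints strictly inside ]a, b[ and within distance e of [x]. *)
have [||| q /andP[q1 q2] Sq] := dense ((2 * lo + hi) / 3) ((lo + 2 * hi) / 3); [lra..|].
exists q; split => //; apply: eB; rewrite /ball /= ltr_norml.
by apply/andP; split; lra.
Qed.

(** Cardano's formula: after multiplication by z^3, where z is [beta_cbrt R], the cubic becomes a
    quadratic in z^3 having [c] as a root. *)
Lemma beta_root (R : realType) :
  8 * beta R ^+ 3 + 5 * beta R ^+ 2 + 2 * beta R + 1 = 0.
Proof.
pose c : R := 3 * Num.sqrt 708 - 629 / 8.
have s2 : Num.sqrt (708 : R) ^+ 2 = 708 by rewrite sqr_sqrtr.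
have s0 : 0 <= Num.sqrt (708 : R) by exact: sqrtr_ge0.
have c0 : 0 < c by rewrite /c; nra.
have z0 : 0 < beta_cbrt R by rewrite /beta_cbrt powR_gt0.
have z3 : beta_cbrt R ^+ 3 = c.
  rewrite /beta_cbrt -/c -powR_mulrn ?powR_ge0 // -powRrM mulVf ?powRr1 ?ltW //.
rewrite /beta; move: (beta_cbrt R) z0 z3 => z z0 z3.
have c2 : c ^+ 2 + 629 / 4 * c - 12167 / 64 = 0 by rewrite /c; lra.
apply: (mulfI (_ : z ^+ 3 != 0)); first by rewrite expf_neq0 // gt_eqF.
rewrite mulr0; transitivity ((z ^+ 6 + 629 / 4 * z ^+ 3 - 12167 / 64) / 216).
  by field; rewrite gt_eqF.
by rewrite (_ : z ^+ 6 = c ^+ 2) ?z3 ?c2 ?mul0r // -z3; ring.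
Qed.

Theorem theorem3p1 (R : realType) (x : R) (hx : beta R <= x <= 0) :
  closure (real_reliability_roots R) x.
Proof.
have sq_gt0 (q : R) : q < 0 -> 0 < (1 - q) ^+ 2 by move=> ?; apply: exprn_gt0; lra.
have [x3|x3] := leP (- 3^-1) x.
  apply: (@closure_dense_itv _ _ (- 3^-1) 0); [lra|by move/andP: hx => []; lra|].
  move=> u v u3 uv v0; have u0 := lt_trans uv v0.
  have pu := sq_gt0 _ u0; have pv := sq_gt0 _ v0.
  apply: (@exists_necklace_root R false); rewrite ?gadget_sep_path ?gadget_tot_path.
  - lra.
  - by apply: mulr_gt0 => //; lra.
  - by apply: mulr_gt0 => //; lra.
  - by apply: mulr_ge0_le0; [exact: ltW|lra].
  - by rewrite -mulrN ltr_pM2l //; lra.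
  - rewrite -subr_gt0.
    rewrite (_ : _ - _ = 2 * (1 - u) ^+ 2 * (1 - v) ^+ 2 * (v - u)); last by ring.
    by apply: mulr_gt0; [do 2![apply: mulr_gt0 => //]|lra].
have b0 := beta_root R.
(* Up to (1 - q)^2 the cubic is S + T for the bridge gadget, so its positivity is the condition -S <
   T. *)
have cubic_gt0 q : beta R < q -> 0 < 8 * q ^+ 3 + 5 * q ^+ 2 + 2 * q + 1.
  move=> bq; rewrite -[X in X < _]b0 -subr_gt0.
  rewrite (_ : _ - _ = (q - beta R) *
    (8 * (q ^+ 2 + q * beta R + beta R ^+ 2) + 5 * (q + beta R) + 2)); last by ring.
  by apply: mulr_gt0; [lra|nra].
apply: (@closure_dense_itv _ _ (beta R) (- 3^-1)); [|by move/andP: hx => []; lra|].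
  by move/andP: hx => []; lra.
move=> u v bu uv v3; have u0 : u < 0 by lra.
have v0 : v < 0 by lra.
have pu := sq_gt0 _ u0; have pv := sq_gt0 _ v0.
have cu := cubic_gt0 _ bu.
have u1 : -1 < u by nra.
have Dpos (q : R) : -1 < q -> 0 < (1 + q) * (1 + q + 2 * q ^+ 2).
  by move=> q1; apply: mulr_gt0; [lra|nra].
apply: (@exists_necklace_root R true); rewrite ?gadget_sep_bridge ?gadget_tot_bridge.
- lra.
- by apply: mulr_gt0 => //; apply: Dpos.
- by apply: mulr_gt0 => //; apply: Dpos; lra.
- apply: mulr_ge0_le0; first exact: ltW.
  by apply: mulr_ge0_le0; [apply: mulr_ge0 => //; apply: sqr_ge0|lra].
- by rewrite -mulrN ltr_pM2l //; nra.
(* Here -S/T is twice the product of q^2/(1+q+2q^2) and -(1+3q)/(1+q), both nonnegative and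
   decreasing on ]-1, -1/3[; the factors are compared separately, cross-multiplied. *)
- rewrite (_ : - _ * _ = (2 * (1 - u) ^+ 2 * (1 - v) ^+ 2) *
    ((v ^+ 2 * (1 + u + 2 * u ^+ 2)) * (- (1 + 3 * v) * (1 + u)))); last by ring.
  rewrite [X in _ < X](_ : _ = (2 * (1 - u) ^+ 2 * (1 - v) ^+ 2) *
    ((u ^+ 2 * (1 + v + 2 * v ^+ 2)) * (- (1 + 3 * u) * (1 + v)))); last by ring.
  rewrite ltr_pM2l; last by do 2![apply: mulr_gt0 => //].
  apply: ltr_pM.
  + by apply: mulr_ge0; [exact: sqr_ge0|nra].
  + by apply: mulr_ge0; lra.
  + rewrite -subr_gt0 (_ : _ - _ = (v - u) * (1 - (1 + u) * (1 + v))); last by ring.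
    by apply: mulr_gt0; [lra|nra].
  + by apply: ltr_pM; lra.
Qed.
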